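(* Let $\mathfrak{g}$ be a Lie algebra over a field $\mathbb{F}$, and let $M$ be a left $\mathfrak{g}$-module. Then the left hemi-semidirect product $\mathfrak{g}\ltimes_\ell M$ is semi-simple (as a left Leibniz algebra) if, and only if, $\mathfrak{g}$ is semi-simple and $\mathfrak{g}M=M$.
   Context: The field $\mathbb{F}$ is arbitrary, and $\mathfrak{g}$ and $M$ may have arbitrary dimension. Ideals are two-sided. A left Leibniz algebra is an $\mathbb{F}$-vector space $\mathfrak{L}$ with a bilinear multiplication satisfying $x(yz)=(xy)z+y(xz)$ for all $x,y,z\in\mathfrak{L}$; every Lie algebra is a left Leibniz algebra. Its Leibniz kernel is the ideal $\mathrm{Leib}(\mathfrak{L}):=\langle x^2\mid x\in\mathfrak{L}\rangle_{\mathbb{F}}$ (the linear span of all squares). A Leibniz algebra $\mathfrak{L}$ is called semi-simple if $\mathrm{Leib}(\mathfrak{L})$ contains every solvable ideal of $\mathfrak{L}$; in particular a Lie algebra (for which the Leibniz kernel is $0$) is semi-simple if its only solvable ideal is $0$. For a Lie algebra $\mathfrak{g}$ and a left $\mathfrak{g}$-module $M$ (i.e. $[x,y]\cdot m=x\cdot(y\cdot m)-y\cdot(x\cdot m)$), the left hemi-semidirect product $\mathfrak{g}\ltimes_\ell M$ is the vector space $\mathfrak{g}\times M$ with multiplication $(g,m)(g',m'):=([g,g'],g\cdot m')$; it is a left Leibniz algebra. Moreover, $\mathfrak{g}M:=\langle g\cdot m\mid g\in\mathfrak{g},m\in M\rangle_{\mathbb{F}}$ (linear span). *)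

(* Defs.v *)
From HB Require Import structures.
From mathcomp Require Import all_boot all_algebra.
From mathcomp Require Import classical_sets.

Set Implicit Arguments.
Unset Strict Implicit.
Unset Printing Implicit Defensive.

Import GRing.Theory.
Local Open Scope ring_scope.
Local Open Scope classical_set_scope.

HB.mixin Record Lmodule_hasProduct (F : fieldType) L of GRing.Lmodule F L := {
  lmul : L -> L -> L;
  lmul_bilinear : bilinear_for *:%R *:%R lmul
}.

#[short(type="nonassocAlgType")]
HB.structure Definition NonassocAlg (F : fieldType) :=
  {L of GRing.Lmodule F L & Lmodule_hasProduct F L}.

HB.instance Definition _ (F : fieldType) (L : nonassocAlgType F) :=
  bilinear_isBilinear.Build F L L L *:%R *:%R (@lmul F L) lmul_bilinear.

HB.mixin Record NonassocAlg_isLeftLeibniz (F : fieldType) L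
    of NonassocAlg F L := {
  lmul_leibniz : forall x y z : L,
    lmul x (lmul y z) = lmul (lmul x y) z + lmul y (lmul x z)
}.

#[short(type="leftLeibnizType")]
HB.structure Definition LeftLeibniz (F : fieldType) :=
  {L of NonassocAlg F L & NonassocAlg_isLeftLeibniz F L}.

(* For an alternating product the left Leibniz identity is equivalent to the
   Jacobi identity: see the factory NonassocAlg_isLie and lemma lie_jacobi. *)
HB.mixin Record LeftLeibniz_isLie (F : fieldType) L of LeftLeibniz F L := {
  lmulxx : forall x : L, lmul x x = 0
}.

#[short(type="lieAlgType")]
HB.structure Definition LieAlg (F : fieldType) :=
  {L of LeftLeibniz F L & LeftLeibniz_isLie F L}.

Lemma alternating_lmulC (F : fieldType) (L : nonassocAlgType F) :
  (forall x : L, lmul x x = 0) -> forall x y : L, lmul x y = - lmul y x.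
Proof.
move=> alt x y; have := alt (x + y).
by rewrite linearDl !linearD /= !alt add0r addr0 => /eqP;
  rewrite addr_eq0 => /eqP.
Qed.

HB.factory Record NonassocAlg_isLie (F : fieldType) L of NonassocAlg F L := {
  lmulxx : forall x : L, lmul x x = 0;
  jacobi : forall x y z : L,
    lmul x (lmul y z) + lmul y (lmul z x) + lmul z (lmul x y) = 0
}.

HB.builders Context (F : fieldType) L of NonassocAlg_isLie F L.

Fact leibniz_subproof (x y z : L) :
  lmul x (lmul y z) = lmul (lmul x y) z + lmul y (lmul x z).
Proof.
have C := alternating_lmulC lmulxx.
have /eqP := jacobi x y z; rewrite -addrA addr_eq0 => /eqP ->.
by rewrite opprD addrC -C (C z x) linearNr opprK.
Qed.

HB.instance Definition _ := NonassocAlg_isLeftLeibniz.Build F L leibniz_subproof.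
HB.instance Definition _ := LeftLeibniz_isLie.Build F L lmulxx.

HB.end.

Lemma lie_jacobi (F : fieldType) (L : lieAlgType F) (x y z : L) :
  lmul x (lmul y z) + lmul y (lmul z x) + lmul z (lmul x y) = 0.
Proof.
have C := alternating_lmulC (@lmulxx F L).
rewrite lmul_leibniz (C z x) linearNr (C z (lmul x y)).
by rewrite addrK subrr.
Qed.

HB.mixin Record Lmodule_isLieModule (F : fieldType) (g : lieAlgType F) M
    of GRing.Lmodule F M := {
  act : g -> M -> M;
  act_bilinear : bilinear_for *:%R *:%R act;
  act_lmul : forall (x y : g) (m : M),
    act (lmul x y) m = act x (act y m) - act y (act x m)
}.

#[short(type="lieModType")]
HB.structure Definition LieModule (F : fieldType) (g : lieAlgType F) :=
  {M of GRing.Lmodule F M & Lmodule_isLieModule F g M}.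

HB.instance Definition _ (F : fieldType) (g : lieAlgType F)
    (M : lieModType g) :=
  bilinear_isBilinear.Build F g M M *:%R *:%R (@act F g M) act_bilinear.

Definition lspan (F : fieldType) (V : lmodType F) (S : set V) : set V :=
  [set v | exists (n : nat) (a : 'I_n -> F) (s : 'I_n -> V),
     (forall i, S (s i)) /\ v = \sum_(i < n) a i *: s i].

Section Leibniz.
Context (F : fieldType) (L : leftLeibnizType F).

Definition is_ideal (I : set L) : Prop :=
  submod_closed (mem I) /\
  forall x y : L, I y -> I (lmul x y) /\ I (lmul y x).

Fixpoint derived (I : set L) (n : nat) : set L :=
  if n is n'.+1 then
    lspan [set z | exists x y : L,
      [/\ derived I n' x, derived I n' y & z = lmul x y]]
  else I.

Definition is_solvable (I : set L) : Prop :=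
  exists n, derived I n = [set 0].

Definition Leib : set L := lspan [set z | exists x : L, z = lmul x x].

End Leibniz.

Arguments Leib {F} L.

Definition semisimple (F : fieldType) (L : leftLeibnizType F) : Prop :=
  forall I : set L, is_ideal I -> is_solvable I -> I `<=` Leib L.

Definition gM (F : fieldType) (g : lieAlgType F) (M : lieModType g) : set M :=
  lspan [set v | exists (x : g) (m : M), v = act x m].

Arguments gM {F} g M.

(* An alias of g * M, carrying the left Leibniz product declared below. *)
Definition hemi_semidirect (F : fieldType) (g : lieAlgType F)
  (M : lieModType g) : Type := (g * M)%type.

Arguments hemi_semidirect {F} g M.

Section HemiSemidirect.
Context (F : fieldType) (g : lieAlgType F) (M : lieModType g).
Local Notation H := (hemi_semidirect g M).

HB.instance Definition _ := GRing.Lmodule.copy H (g * M)%type.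

Definition hemi_mul (u v : H) : H := (lmul u.1 v.1, act u.1 v.2).

Fact hemi_mul_bilinear : bilinear_for *:%R *:%R hemi_mul.
Proof.
split=> w a u v; apply: injective_projections => /=.
- exact: (linearPl lmul).
- exact: (linearPl act).
- exact: (linearPr lmul).
- exact: (linearPr act).
Qed.

HB.instance Definition _ := Lmodule_hasProduct.Build F H hemi_mul_bilinear.

Fact hemi_mul_leibniz (x y z : H) :
  lmul x (lmul y z) = lmul (lmul x y) z + lmul y (lmul x z).
Proof.
apply: injective_projections => /=; first exact: lmul_leibniz.
by rewrite act_lmul subrK.
Qed.

HB.instance Definition _ := NonassocAlg_isLeftLeibniz.Build F H hemi_mul_leibniz.

End HemiSemidirect.

(* Main.v *)
From HB Require Import structures.
Require Import Defs.
From mathcomp Require Import all_boot all_algebra.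
From mathcomp Require Import classical_sets.

(* Squares in [hemi_semidirect g M] are the elements [(0, x m)], so its Leibniz
   kernel is [0 x gM]. The first projection [p] onto [g] is a surjective
   homomorphism whose kernel [0 x M] has zero product; hence an ideal of [g] is
   solvable iff its preimage is, and the image of a solvable ideal is solvable.
   Semi-simplicity then says precisely that solvable ideals of [g] vanish and
   that the solvable ideal [0 x M] lies in [0 x gM]. *)

Set Implicit Arguments.
Unset Strict Implicit.
Unset Printing Implicit Defensive.

Import GRing.Theory.
Local Open Scope ring_scope.
Local Open Scope classical_set_scope.

Section LinearSpan.
Context (F : fieldType).

(** Trades the boolean membership of [mem T] for the proposition [T u], so that closure can be used
    and proved directly on classical sets. *)
Lemma submod_closed_setP (V : lmodType F) (T : set V) :
  submod_closed (mem T) <->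
  T 0 /\ forall (a : F) (u v : V), T u -> T v -> T (a *: u + v).
Proof.
split=> -[T0 TL]; split; first by rewrite -in_setE.
- by move=> a u v Tu Tv; rewrite -in_setE; apply: TL; rewrite in_setE.
- by rewrite in_setE.
by move=> a u v; rewrite !in_setE; apply: TL.
Qed.

Lemma lspan0 (V : lmodType F) (S : set V) : lspan S 0.
Proof.
exists 0, (fun=> 0), (fun=> 0); split; first by case.
by rewrite big_ord0.
Qed.

Lemma lspan_sub (V : lmodType F) (S T : set V) :
  submod_closed (mem T) -> S `<=` T -> lspan S `<=` T.
Proof.
move=> /submod_closed_setP[T0 TL] ST _ [n [a [s [Ss ->]]]].
elim/big_ind: _ => // [u v Tu Tv|i _].
- by rewrite -[u]scale1r; apply: TL.
- by rewrite -[_ *: _]addr0; apply: TL => //; apply/ST/Ss.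
Qed.

Lemma image_lspan (V W : lmodType F) (f : {linear V -> W}) (S : set V) :
  f @` lspan S = lspan (f @` S).
Proof.
apply/seteqP; split=> [_ [_ [n [a [s [Ss ->]]]] <-]|_ [n [a [s [Ss ->]]]]].
  exists n, a, (f \o s); split=> [i|]; first by exists (s i).
  by rewrite linear_sum; apply: eq_bigr => i _; rewrite linearZ.
(* Choice selects preimages in [S] of all the generators [s i] at once; the same coefficients then
   give a preimage of the combination. *)
have /boolp.choice[t tP] i : exists v, S v /\ f v = s i.
  by have [v Sv <-] := Ss i; exists v.
exists (\sum_(i < n) a i *: t i).
  by exists n, a, t; split=> // i; case: (tP i).
rewrite linear_sum; apply: eq_bigr => i _.
by rewrite linearZ /=; case: (tP i) => _ ->.
Qed.

Lemma submod_closed_set0 (V : lmodType F) : submod_closed (mem [set 0 : V]).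
Proof.
apply/submod_closed_setP; split=> // a u v /= -> ->.
by rewrite scaler0 addr0.
Qed.

End LinearSpan.

Section Ideals.
Context (F : fieldType).

Lemma Leib_lie (L : lieAlgType F) : Leib L `<=` [set 0].
Proof.
apply: lspan_sub; first exact: submod_closed_set0.
by move=> _ [x ->]; apply: lmulxx.
Qed.

Section Morphism.
Context (L L' : leftLeibnizType F) (f : {linear L -> L'}).
Hypothesis fM : {morph f : x y / lmul x y}.

(** Induction on [n]: [f] commutes with products, and linear maps commute with spans. *)
Lemma image_derived (I : set L) (n : nat) :
  f @` derived I n = derived (f @` I) n.
Proof.
elim: n => [//|n IHn] /=; rewrite image_lspan -IHn.
congr lspan; apply/seteqP; split=> [_ [_ [x [y [Ix Iy ->]]] <-]|z].
  by exists (f x), (f y); split; [exists x|exists y|exact: fM].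
move=> [_ [_ [[x Ix <-] [y Iy <-] ->]]].
by exists (lmul x y); [exists x, y|exact: fM].
Qed.

Lemma preimage_ideal (I : set L') : is_ideal I -> is_ideal (f @^-1` I).
Proof.
move=> [/submod_closed_setP[I0 IL] IM]; split.
  apply/submod_closed_setP; split=> [|a u v Iu Iv]; rewrite /preimage /=.
    by rewrite linear0.
  by rewrite linearP; apply: IL.
by move=> x y Iy; rewrite /preimage /= !fM; apply: IM.
Qed.

Lemma image_ideal (I : set L) :
  (forall y, exists x, f x = y) -> is_ideal I -> is_ideal (f @` I).
Proof.
move=> f_surj [/submod_closed_setP[I0 IL] IM]; split.
  apply/submod_closed_setP; split; first by exists 0; rewrite ?linear0.
  move=> a _ _ [u Iu <-] [v Iv <-].
  by exists (a *: u + v); [apply: IL|rewrite linearP].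
(* The multiplier [x'] is arbitrary in [L']; surjectivity lifts it to [L], where [I] absorbs it. *)
move=> x' _ [y Iy <-]; have [x <-] := f_surj x'.
by have [Ixy Iyx] := IM x y Iy; split;
  [exists (lmul x y)|exists (lmul y x)]; rewrite ?fM.
Qed.

Lemma image_solvable (I : set L) : is_solvable I -> is_solvable (f @` I).
Proof.
by move=> [n In]; exists n; rewrite -image_derived In image_set1 linear0.
Qed.

Lemma preimage_solvable (I : set L') :
  (forall y, exists x, f x = y) ->
  (forall x y, f x = 0 -> f y = 0 -> lmul x y = 0) ->
  is_solvable I -> is_solvable (f @^-1` I).
Proof.
(* After [n] steps the derived series of the preimage lies in the kernel of [f]; one more step kills
   it, since products in the kernel vanish. *)
move=> f_surj kerM [n In]; exists n.+1.
have fI : f @` (f @^-1` I) = I.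
  apply: image_preimage; apply/seteqP; split=> // y _.
  by have [x] := f_surj y; exists x.
have ker x : derived (f @^-1` I) n x -> f x = 0.
  move=> Dx; have : (f @` derived (f @^-1` I) n) (f x) by exists x.
  by rewrite image_derived fI In.
apply/seteqP; split=> [|_ ->]; last exact: lspan0.
apply: lspan_sub; first exact: submod_closed_set0.
by move=> _ [x [y [/ker fx0 /ker fy0 ->]]]; apply: kerM.
Qed.

End Morphism.

Lemma set0_ideal (L : leftLeibnizType F) : is_ideal [set 0 : L].
Proof.
split; first exact: submod_closed_set0.
by move=> x y ->; split=> /=; rewrite ?linear0r ?linear0l.
Qed.

Lemma set0_solvable (L : leftLeibnizType F) : is_solvable [set 0 : L].
Proof. by exists 0. Qed.

End Ideals.

Section HemiSemidirect.
Context (F : fieldType) (g : lieAlgType F) (M : lieModType g).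
Local Notation H := (hemi_semidirect g M).

Definition hemi_fst : H -> g := fst.

Fact hemi_fst_linear : linear hemi_fst.
Proof. by []. Qed.

HB.instance Definition _ :=
  GRing.isLinear.Build F H g *:%R hemi_fst hemi_fst_linear.

Definition hemi_inr (m : M) : H := (0, m).

Fact hemi_inr_linear : linear hemi_inr.
Proof.
by move=> a u v; apply: injective_projections; rewrite //= scaler0 addr0.
Qed.

HB.instance Definition _ :=
  GRing.isLinear.Build F M H *:%R hemi_inr hemi_inr_linear.

Lemma hemi_fstM : {morph hemi_fst : x y / lmul x y}.
Proof. by []. Qed.

Lemma hemi_fst_surj (x : g) : exists y, hemi_fst y = x.
Proof. by exists (x, 0). Qed.

Lemma hemi_fst_ker_mul (x y : H) :
  hemi_fst x = 0 -> hemi_fst y = 0 -> lmul x y = 0.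
Proof.
by move=> x0 _; apply: injective_projections; rewrite /= [x.1]x0 linear0l.
Qed.

(** Both sides are spans of the same generators: the square of [(x, m)] is [(lmul x x, act x m)],
    and [lmul x x = 0]. *)
Lemma Leib_hemi : Leib H = hemi_inr @` gM g M.
Proof.
rewrite image_lspan; congr lspan; apply/seteqP; split=> [_ [x ->]|z].
  exists (act x.1 x.2); first by exists x.1, x.2.
  by apply: injective_projections; rewrite //= lmulxx.
move=> [_ [x [m ->]] <-]; exists ((x, m) : H).
by apply: injective_projections; rewrite //= lmulxx.
Qed.

End HemiSemidirect.

Theorem theorem2p1 (F : fieldType) (g : lieAlgType F) (M : lieModType g) :
  semisimple (hemi_semidirect g M) <->
  (semisimple g /\ gM g M = [set: M]%classic).
Proof.
pose p := @hemi_fst F g M; pose i := @hemi_inr F g M.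
have pM := @hemi_fstM F g M; have p_surj := @hemi_fst_surj F g M.
have kerM := @hemi_fst_ker_mul F g M.
split=> [ssH|[ssg gMT] J idJ solJ].
  have sub I : is_ideal I -> is_solvable I ->
      p @^-1` I `<=` i @` gM g M.
    move=> idI solI; rewrite -Leib_hemi; apply: ssH.
    - exact: preimage_ideal.
    - exact: preimage_solvable.
  split=> [I idI solI x Ix|].
    have [m _ [<- _]] : (i @` gM g M) (x, 0) by apply: (sub I).
    exact: lspan0.
  apply/seteqP; split=> // m _.
  (* The preimage of the zero ideal is [0 x M], which contains [(0, m)]. *)
  have [m' gMm' [<-]] : (i @` gM g M) (0, m).
    by apply: (sub [set 0]); [exact: set0_ideal|exact: set0_solvable|].
  exact: gMm'.
have pJ0 : p @` J `<=` [set 0].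
  apply: subset_trans (@Leib_lie F g); apply: ssg.
  - exact: image_ideal.
  - exact: image_solvable.
(* By [pJ0] the first component of [x] vanishes, so [x] is the image of [x.2] under [i]. *)
move=> x Jx; rewrite Leib_hemi gMT; exists x.2 => //.
apply: injective_projections => //=.
by apply/esym/pJ0; exists x.
Qed.
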